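(* Let $M$ be an infinite pointed metric space and let $n\in\mathbb{N}$. Then there is an $n$-dimensional linear subspace of $\mathrm{Lip}_0(M)$ which is contained in $\mathrm{SNA}(M)$ and is isometric to $\ell_1^n$.
   Context: All vector spaces are real and $\mathbb{N}=\{1,2,\dots\}$. A pointed metric space $(M,\rho)$ is a metric space with at least 2 points and a distinguished point $0\in M$. $\mathrm{Lip}_0(M)$ is the Banach space of all Lipschitz functions $f:M\to\mathbb{R}$ with $f(0)=0$, normed by the Lipschitz constant $\|f\|=\sup\{|f(x)-f(y)|/\rho(x,y): x,y\in M,\ x\neq y\}$. A function $f\in\mathrm{Lip}_0(M)$ attains its norm strongly if there are $x\neq y$ in $M$ with $\|f\|=|f(x)-f(y)|/\rho(x,y)$; $\mathrm{SNA}(M)\subset\mathrm{Lip}_0(M)$ is the set of all such $f$. $\ell_1^n$ is $\mathbb{R}^n$ with the norm $\|(x_1,\dots,x_n)\|_1=\sum_{k=1}^n|x_k|$. ''Isometric'' means linearly isometric. *)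

(* Defs.v *)
From HB Require Import structures.
From mathcomp Require Import all_boot all_order all_algebra.
From mathcomp Require Import all_classical all_reals all_analysis.
Set Implicit Arguments.
Unset Strict Implicit.
Unset Printing Implicit Defensive.
Import Order.TTheory GRing.Theory Num.Theory.
Import numFieldNormedType.Exports.
Local Open Scope classical_set_scope.
Local Open Scope ring_scope.

Section lip0.
Context {R : realType} {M : metricType R}.
Implicit Types (o x y : M) (f g : M -> R).

(* The library's [lipschitz] requires a normed module as domain. *)
Definition lipschitz_fun f : Prop :=
  exists k : R, forall x y, `|f x - f y| <= k * mdist x y.

Definition slope f x y : R := `|f x - f y| / mdist x y.

Definition slopes f : set R :=
  [set r | exists x y, x != y /\ r = slope f x y].

Definition lip_const f : R := sup (slopes f).

Definition lip0_pred o : {pred M -> R} :=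
  mem [set f | f o = 0 /\ lipschitz_fun f].

Lemma slopes_ub f : lipschitz_fun f -> has_ubound (slopes f).
Proof.
move=> [k fk]; exists k => r [x [y [xy ->]]].
by rewrite ler_pdivrMr ?mdist_gt0.
Qed.

Lemma slope_le f x y : lipschitz_fun f -> x != y -> slope f x y <= lip_const f.
Proof.
by move=> lf xy; apply: ub_le_sup; [exact: slopes_ub|exists x, y].
Qed.

Lemma lip_const_ge0 f : 0 <= lip_const f.
Proof.
rewrite /lip_const; have [hs|/sup_out ->//] := pselect (has_sup (slopes f)).
have [[r fr] bf] := hs; apply: (le_trans _ (ub_le_sup bf fr)).
by case: fr => x [y [_ ->]]; rewrite divr_ge0// mdist_ge0.
Qed.

Lemma lip_const_le f (k : R) : 0 <= k ->
  (forall x y, x != y -> slope f x y <= k) -> lip_const f <= k.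
Proof.
move=> k0 fk; rewrite /lip_const.
have [->|/set0P s0] := eqVneq (slopes f) set0; first by rewrite sup0.
by apply: ge_sup => // r [x [y [xy ->]]]; exact: fk.
Qed.

Lemma lip0_submod_closed o : submod_closed (lip0_pred o).
Proof.
split.
  by rewrite inE/=; split=> //; exists 0 => x y; rewrite subrr normr0 mul0r.
move=> a f g; rewrite !inE/= => -[f0 [k fk]] [g0 [l gl]]; split.
  by rewrite !fctE f0 g0 scaler0 addr0.
exists (`|a| * k + l) => x y; rewrite !fctE opprD addrACA -scalerBr.
rewrite (le_trans (ler_normD _ _))// normrZ mulrDl -mulrA.
by rewrite lerD// ler_wpM2l.
Qed.

End lip0.

Record Lip0 {R : realType} {M : metricType R} (o : M) := MkLip0 {
  Lip0_val :> M -> R ;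
  Lip0_valP : Lip0_val \in lip0_pred o }.

Section Lip0_lmod.
Context {R : realType} {M : metricType R} (o : M).

HB.instance Definition _ := [isSub for @Lip0_val R M o].
HB.instance Definition _ := [Choice of Lip0 o by <:].
HB.instance Definition _ :=
  GRing.isSubmodClosed.Build R (M -> R) (lip0_pred o) (lip0_submod_closed o).
HB.instance Definition _ := [SubChoice_isSubLmodule of Lip0 o by <:].

Lemma Lip0_base (f : Lip0 o) : f o = 0.
Proof. by have := Lip0_valP f; rewrite inE => -[]. Qed.

Lemma Lip0_lipschitz (f : Lip0 o) : lipschitz_fun f.
Proof. by have := Lip0_valP f; rewrite inE => -[]. Qed.

Let nrm (f : Lip0 o) : R := lip_const f.

Let nrmD f g : nrm (f + g) <= nrm f + nrm g.
Proof.
apply: lip_const_le => [|x y xy]; first by rewrite addr_ge0// lip_const_ge0.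
apply: (@le_trans _ _ (slope f x y + slope g x y)).
  rewrite /slope -mulrDl ler_wpM2r ?invr_ge0 ?mdist_ge0//.
  by rewrite [X in `|X|](_ : _ = (f x - f y) + (g x - g y)) ?ler_normD// addrACA -opprD.
by rewrite lerD// slope_le//; exact: Lip0_lipschitz.
Qed.

Let nrmZ_le (a : R) f : nrm (a *: f) <= `|a| * nrm f.
Proof.
apply: lip_const_le => [|x y xy]; first by rewrite mulr_ge0// lip_const_ge0.
rewrite /slope [X in `|X|](_ : _ = a * (f x - f y)); last by rewrite mulrBr.
by rewrite normrM -mulrA ler_wpM2l// slope_le//; exact: Lip0_lipschitz.
Qed.

Let nrmZ (a : R) f : nrm (a *: f) = `|a| * nrm f.
Proof.
apply/eqP; rewrite eq_le nrmZ_le/=.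
have [->|a0] := eqVneq a 0; first by rewrite normr0 mul0r lip_const_ge0.
rewrite -ler_pdivlMl ?normr_gt0// -normfV.
by have := nrmZ_le a^-1 (a *: f); rewrite scalerK.
Qed.

Let nrm0 f : nrm f = 0 -> f = 0.
Proof.
move=> f0; apply/val_inj/funext => x; have [->|xo] := eqVneq x o.
  exact: Lip0_base.
have := slope_le (Lip0_lipschitz f) xo; rewrite -/(nrm f) f0 /slope.
rewrite Lip0_base subr0 pmulr_lle0 ?invr_gt0 ?mdist_gt0//.
by rewrite normr_le0 => /eqP.
Qed.

HB.instance Definition _ := Lmodule_isNormed.Build R (Lip0 o) nrmD nrmZ nrm0.

Lemma Lip0_normE (f : Lip0 o) : `|f| = lip_const f.
Proof. by []. Qed.

End Lip0_lmod.

Definition SNA {R : realType} {M : metricType R} (o : M) : set (Lip0 o) :=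
  [set f : Lip0 o | exists x y, x != y /\ `|f| = `|f x - f y| / mdist x y].
Arguments SNA {R M} o.

(* An alias, since the norm of the library on 'rV[R]_n is the sup norm. *)
Definition ell1 (R : realType) (n : nat) : Type := 'rV[R]_n.

Section ell1.
Context (R : realType) (n : nat).

HB.instance Definition _ := GRing.Lmodule.copy (ell1 R n) 'rV[R]_n.

Let nrm (x : ell1 R n) : R := \sum_(k < n) `|(x : 'rV[R]_n) 0 k|.

Let nrmD x y : nrm (x + y) <= nrm x + nrm y.
Proof.
by rewrite -big_split/=; apply: ler_sum => k _; rewrite mxE ler_normD.
Qed.

Let nrmZ (a : R) x : nrm (a *: x) = `|a| * nrm x.
Proof. by rewrite mulr_sumr; apply: eq_bigr => k _; rewrite mxE normrM. Qed.

Let nrm0 x : nrm x = 0 -> x = 0.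
Proof.
move=> /eqP; rewrite psumr_eq0// => /allP x0; apply/rowP => k.
by have := x0 k; rewrite mem_index_enum normr_eq0 mxE => /(_ isT)/eqP.
Qed.

HB.instance Definition _ := Lmodule_isNormed.Build R (ell1 R n) nrmD nrmZ nrm0.

Lemma ell1_normE (x : ell1 R n) : `|x| = \sum_(k < n) `|(x : 'rV[R]_n) 0 k|.
Proof. by []. Qed.

End ell1.

Definition subspace_of {R : realType} {E : lmodType R} (V : set E) : Prop :=
  submod_closed (mem V : {pred E}).

Definition has_dim {R : realType} {E : lmodType R} (V : set E) (n : nat) :
    Prop :=
  exists e : 'I_n -> E,
    (forall a : 'I_n -> R, \sum_i a i *: e i = 0 -> forall i, a i = 0) /\
    V = [set v | exists a : 'I_n -> R, v = \sum_i a i *: e i].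

(* The subspace V, with the norm of E, is linearly isometric to F; a map
   preserving the norm is injective, so only its image needs specifying. *)
Definition isometric_to {R : realType} {E : normedModType R} (V : set E)
    (F : normedModType R) : Prop :=
  exists T : {linear F -> E}, (forall x, `|T x| = `|x|) /\ range T = V.

(* Main.v *)
Require Import Defs.
From HB Require Import structures.
From mathcomp Require Import all_boot all_order all_algebra.
From mathcomp Require Import perm.
From mathcomp Require Import all_classical all_reals all_analysis.
From mathcomp Require Import lra.
Import Order.TTheory GRing.Theory Num.Theory.
Import numFieldNormedType.Exports.
Local Open Scope classical_set_scope.
Local Open Scope ring_scope.

(** Suppose that f_1, ..., f_n are 1-Lipschitz and that for every sign pattern
    s in {1, -1}^n there is a pair of distinct points x_s, y_s with
    f_k(x_s) - f_k(y_s) = s_k d(x_s, y_s) for all k. Then any combination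
    a_1 f_1 + ... + a_n f_n has Lipschitz constant at most
    |a_1| + ... + |a_n|, and its slope at the pair whose pattern is the sign
    pattern of a equals this number. Hence the f_k, normalized at the base
    point, span an isometric copy of ell_1^n that consists of strongly norm
    attaining functions ([ell1_attained]).

    Pairs and functions of this kind come from a perfect matching of minimal
    total length ([optimal_matching]). Take twice as many distinct points as
    there are sign patterns, match them optimally, and index the matched pairs
    by the patterns. For each k, orient the pair s according to s_k. Reassigning
    the second endpoints among the first ones gives another perfect matching,
    so the oriented pairs form an optimal transport plan between their first
    and second endpoints, whatever the orientation. A dual optimal solution
    (a Kantorovich potential, [kantorovich_potential]) is the 1-Lipschitz
    function f_k: it has slope exactly 1 along each oriented pair. One matching
    serves all n orientations at once.

    The potential is obtained from shortest paths. Let the arc from i to j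
    have weight d(x_i, y_j) - d(x_j, y_j). Optimality says that closed simple
    walks have nonnegative weight, so that shortest simple paths satisfy the
    triangle inequality ([shortest_path_potential]). *)

(** The walk starts at [i] and visits the entries of [s] in turn. *)
Fixpoint walk_weight {R : zmodType} {I : Type} (w : I -> I -> R) (i : I)
    (s : seq I) : R :=
  if s is j :: s' then w i j + walk_weight w j s' else 0.

Lemma walk_weight_cat {R : zmodType} {I : Type} (w : I -> I -> R) i s1 s2 :
  walk_weight w i (s1 ++ s2) =
  walk_weight w i s1 + walk_weight w (last i s1) s2.
Proof. by elim: s1 i => [|j s1 IH] i /=; rewrite ?add0r// IH addrA. Qed.

(** For [i0 := i] the left-hand side is the sum of [w] along the cyclic
    permutation [next (i :: s)]; the induction needs an arbitrary endpoint. *)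
Lemma sum_next_at {R : zmodType} {I : eqType} (w : I -> I -> R) i0 i s :
  uniq (i :: s) ->
  \sum_(x <- i :: s) w x (next_at x i0 i s) = walk_weight w i (rcons s i0).
Proof.
elim: s i => [|j s IH] i; first by rewrite big_seq1 /= eqxx addr0.
move=> /= /andP[ijs ujs]; rewrite big_cons /= eqxx -IH//; congr (_ + _).
rewrite big_seq_cond [RHS]big_seq_cond; apply: eq_bigr => x /andP[xjs _].
by rewrite ifN//; apply: contraNneq ijs => <-.
Qed.

(** [u i] is the least weight of a simple path issued from [i]. Prefixing the
    arc from [i] to a best path from [j] yields either a simple path from [i]
    or one that returns to [i]; in that case the initial closed walk has
    nonnegative weight and can be cut off. *)
Lemma shortest_path_potential {R : realDomainType} {I : finType}
    (w : I -> I -> R) :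
  (forall i s, uniq (i :: s) -> 0 <= walk_weight w i (rcons s i)) ->
  exists u : I -> R, forall i j, u i <= w i j + u j.
Proof.
move=> w_ge0.
(* Simple paths have bounded length, so they range over a finite type. *)
pose F i (s : #|I|.-bseq I) := walk_weight w i s.
pose best i := [arg min_(s < [bseq] | uniq (i :: s)) F i s]%O.
exists (fun i => F i (best i)) => i j.
have minF (s : seq I) : uniq (i :: s) -> F i (best i) <= walk_weight w i s.
  move=> uis; have szs : (size s <= #|I|)%N.
    by move: uis => /= /andP[_ /card_uniqP <-]; exact: max_card.
  by rewrite /best; case: arg_minP => // b _ /(_ (Bseq szs)); exact.
have : uniq (j :: best j) by rewrite /best; case: arg_minP.
rewrite [F j _]/F; move: (best j : seq I) => s ujs.
rewrite -[w i j + _]/(walk_weight w i (j :: s)).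
have [ijs|ijs] := boolP (i \in j :: s); last first.
  by apply: minF; rewrite cons_uniq ijs.
case/splitPr: ijs ujs => p1 p2; rewrite -[i :: p2]cat1s uniq_catCA => u12.
rewrite catA walk_weight_cat cats1 last_rcons.
apply: (@le_trans _ _ (walk_weight w i p2)).
  by apply: minF; apply: subseq_uniq u12; rewrite /= eqxx suffix_subseq.
rewrite lerDr w_ge0//; apply: subseq_uniq u12.
by rewrite /= eqxx prefix_subseq.
Qed.

(** Kantorovich duality for an optimal assignment of the [y i] to the [x i].
    With [u] a potential for the weights [w] below, [f] is the largest
    1-Lipschitz function with values at most [u j - d(x_j, y_j)] at [y j];
    the inequalities satisfied by [u] say that [f (x i)] is still at least
    [u i]. *)
Lemma kantorovich_potential {R : realFieldType} {M : metricType R}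
    {I : finType} (i0 : I) (x y : I -> M) :
  (forall pi : I -> I, injective pi ->
    \sum_i mdist (x i) (y i) <= \sum_i mdist (x i) (y (pi i))) ->
  exists f : M -> R,
    (forall a b, f a - f b <= mdist a b) /\
    (forall i, f (x i) - f (y i) = mdist (x i) (y i)).
Proof.
move=> opt; pose w i j := mdist (x i) (y j) - mdist (x j) (y j).
have [i s uis|u uP] := shortest_path_potential w.
  (* A simple cycle is a permutation; the points off the cycle are fixed by it
     and contribute w k k = 0. *)
  rewrite -sum_next_at// big_uniq//; set pi := next (i :: s).
  have pi_inj : injective pi by exact: can_inj (prev_next uis).
  have : 0 <= \sum_k w k (pi k).
    rewrite sumrB subr_ge0 -(reindex_inj pi_inj (P := xpredT)
      (F := fun k => mdist (x k) (y k))); exact: opt.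
  rewrite (bigID (mem (i :: s)))/= [X in _ + X]big1 ?addr0// => k kis.
  by rewrite /pi next_nth (negPf kis) /w subrr.
pose g j a := u j - mdist (x j) (y j) + mdist a (y j).
pose f a := g [arg min_(j < i0) g j a]%O a.
have fg a j : f a <= g j a by rewrite /f; case: arg_minP => // b _; exact.
have fE a : exists j, f a = g j a by eexists.
have f_lip a b : f a - f b <= mdist a b.
  have [j ->] := fE b; have := fg a j; have := metric_triangle a b (y j).
  rewrite /g; lra.
exists f; split => // i; apply/eqP; rewrite eq_le f_lip /=.
have [j ->] := fE (x i); have := fg (y i) i; have := uP i j.
rewrite /g /w mdistxx; lra.
Qed.

(** A perfect matching is encoded by a permutation of [I * bool], the matched
    pairs being the images of [(i, true)] and [(i, false)]. The orientation
    [o] swaps the ends of some pairs and [pi] exchanges second ends, so their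
    combination is again a permutation of [I * bool] and cannot be cheaper
    than the optimal one. *)
Lemma optimal_matching {R : realFieldType} {M : metricType R} {I : finType}
    (p : I * bool -> M) : injective p ->
  exists2 q : I * bool -> M, injective q &
    forall (o : I -> bool) (pi : I -> I), injective pi ->
    \sum_i mdist (q (i, o i)) (q (i, ~~ o i)) <=
    \sum_i mdist (q (i, o i)) (q (pi i, ~~ o (pi i))).
Proof.
move=> p_inj.
pose cost (t : {perm I * bool}) :=
  \sum_i mdist (p (t (i, true))) (p (t (i, false))).
pose t := [arg min_(t < (1%g : {perm I * bool})) cost t]%O.
have tP t' : cost t <= cost t' by rewrite /t; case: arg_minP => // b _; exact.
exists (p \o t) => [|o pi pi_inj].
  by apply: inj_comp => //; exact: perm_inj.
pose k (z : I * bool) := if z.2 then (z.1, o z.1) else (pi z.1, ~~ o (pi z.1)).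
have k_inj : injective k.
  move=> [i [|]] [j [|]] //=.
  - by case=> ->.
  - by case=> ->; case: (o _).
  - by case=> <-; case: (o _).
  - by case=> /pi_inj ->.
have := tP (perm k_inj * t)%g; rewrite /cost.
under [X in _ <= X]eq_bigr do rewrite !permM !permE /k /=.
apply: le_trans; apply: ler_sum => i _ /=.
by case: (o i) => //=; rewrite metric_sym.
Qed.

(** The matched pairs are indexed by the sign patterns themselves ([true]
    standing for a plus sign), and the function [f k] is a potential for the
    orientation given by the [k]-th sign. *)
Lemma sign_pattern_family {R : realType} {M : metricType R} (n : nat) :
  infinite_set [set: M] ->
  exists (q : {ffun 'I_n -> bool} * bool -> M) (f : 'I_n -> M -> R),
  [/\ injective q, forall k a b, f k a - f k b <= mdist a b &
    forall k s, f k (q (s, true)) - f k (q (s, false)) =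
      (-1) ^+ (~~ s k) * mdist (q (s, true)) (q (s, false))].
Proof.
move=> Minf; pose I := {ffun 'I_n -> bool} : finType.
have [p p_inj] : exists p : I * bool -> M, injective p.
  have [x0 _] := infinite_setN0 Minf.
  have [B _ cardB] := infinite_set_fset #|{: I * bool}| Minf.
  have ltB (z : {: I * bool}) : (enum_rank z < size (finmap.enum_fset B))%N.
    exact: leq_trans (ltn_ord _) cardB.
  exists (fun z => nth x0 (finmap.enum_fset B) (enum_rank z)) => z1 z2 /eqP.
  by rewrite nth_uniq ?ltB ?finmap.fset_uniq// => /eqP/ord_inj/enum_rank_inj.
have [q q_inj qopt] := optimal_matching p p_inj.
have fP (k : 'I_n) : exists f : M -> R, (forall a b, f a - f b <= mdist a b) /\
    forall s : I, f (q (s, s k)) - f (q (s, ~~ s k)) =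
      mdist (q (s, s k)) (q (s, ~~ s k)).
  exact: (kantorovich_potential [ffun=> true] (fun s => q (s, s k))
            (fun s => q (s, ~~ s k)) (qopt (fun s : I => s k))).
have [f {}fP] := choice fP.
exists q, f; split=> // [k|k s]; first by have [] := fP k.
have [_ /(_ s)] := fP k; case: (s k) => /=; first by rewrite mul1r.
by rewrite metric_sym mulN1r => <-; rewrite opprB.
Qed.

Lemma ell1_attained {R : realType} {M : metricType R} (o : M) (n : nat) :
  infinite_set [set: M] ->
  exists e : 'I_n -> Lip0 o, forall a : 'I_n -> R,
    `|\sum_k a k *: e k| = \sum_k `|a k| /\ SNA o (\sum_k a k *: e k).
Proof.
move=> /(sign_pattern_family n)[q [f [q_inj f_lip f_sgn]]].
have fP k : (fun x => f k x - f k o) \in lip0_pred o.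
  rewrite inE /=; split; first by rewrite subrr.
  exists 1 => x y; rewrite mul1r opprB addrA subrK ler_norml f_lip andbT.
  by rewrite lerNl opprB metric_sym.
exists (fun k => MkLip0 (fP k)) => a.
set v := \sum_k _.
have vE x y : v x - v y = \sum_k a k * (f k x - f k y).
  rewrite /v; apply: (big_rec2 (fun (u : Lip0 o) r => u x - u y = r)).
    by rewrite [LHS]subrr.
  move=> k u r _ <-.
  rewrite -[LHS]/(a k * (f k x - f k o) + u x - (a k * (f k y - f k o) + u y)).
  rewrite opprD addrACA -mulrBr; congr (_ * _ + _).
  by rewrite opprB addrA subrK.
have v_le : `|v| <= \sum_k `|a k|.
  rewrite Lip0_normE; apply: lip_const_le => [|x y xy].
    exact: sumr_ge0.
  rewrite /slope vE ler_pdivrMr ?mdist_gt0// mulr_suml.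
  apply: le_trans (ler_norm_sum _ _ _) _; apply: ler_sum => k _.
  rewrite normrM ler_wpM2l// ler_norml f_lip andbT.
  by rewrite lerNl opprB metric_sym.
pose s := [ffun k => 0 <= a k].
have qs : q (s, true) != q (s, false) by apply/eqP => /q_inj.
have vs : slope v (q (s, true)) (q (s, false)) = \sum_k `|a k|.
  rewrite /slope vE; under eq_bigr => k _.
    rewrite f_sgn mulrA (_ : a k * _ = `|a k|); first over.
    rewrite ffunE; have [ak|ak] := leP 0 (a k); first by rewrite mulr1 ger0_norm.
    by rewrite mulrN1 ltr0_norm.
  rewrite -mulr_suml normrM (ger0_norm (mdist_ge0 _ _)).
  by rewrite mulfK ?gt_eqF ?mdist_gt0// ger0_norm// sumr_ge0.
have vn : `|v| = \sum_k `|a k|.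
  by apply/eqP; rewrite eq_le v_le/= -vs slope_le//; exact: Lip0_lipschitz.
by split=> //; exists (q (s, true)), (q (s, false)); split=> //; rewrite vn -vs.
Qed.

Theorem corollary2p7 (R : realType) (M : metricType R) (o : M)
    (hM : infinite_set [set: M]) (n : nat) (hn : (0 < n)%N) :
  exists V : set (Lip0 o),
    [/\ subspace_of V, has_dim V n, V `<=` SNA o & isometric_to V (ell1 R n)].
Proof.
have [e eP] := ell1_attained o n hM.
exists [set v | exists a : 'I_n -> R, v = \sum_k a k *: e k]; split.
- split.
    rewrite inE/=; exists (fun=> 0).
    by rewrite big1// => k _; rewrite scale0r.
  move=> c u v; rewrite !inE/= => -[a ->] [b ->]; exists (fun k => c * a k + b k).
  rewrite scaler_sumr -big_split/=; apply: eq_bigr => k _.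
  by rewrite scalerDl scalerA.
- exists e; split=> // a a0 k; have [+ _] := eP a.
  rewrite a0 normr0 => /esym/eqP; rewrite psumr_eq0// => /allP /(_ k).
  by rewrite mem_index_enum normr_eq0 => /(_ isT)/eqP.
- by move=> _ [a ->]; have [] := eP a.
pose T (x : ell1 R n) : Lip0 o := \sum_k (x : 'rV[R]_n) 0 k *: e k.
have T_lin : linear T.
  move=> c x y; rewrite /T scaler_sumr -big_split/=; apply: eq_bigr => k _.
  by rewrite !mxE scalerDl scalerA.
pose mT := GRing.isLinear.Build R (ell1 R n) (Lip0 o) _ T T_lin.
pose Tl : {linear ell1 R n -> Lip0 o} := HB.pack T mT.
exists Tl; split=> [x|].
  by rewrite ell1_normE; have [] := eP (fun k => (x : 'rV[R]_n) 0 k).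
apply/seteqP; split=> [_ [x _ <-]|_ [a ->]].
  by exists (fun k => (x : 'rV[R]_n) 0 k).
exists (\row_k a k : 'rV[R]_n) => //; apply: eq_bigr => k _.
by rewrite mxE.
Qed.
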